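(* Let $q\geq 3$ be an integer. For every positive integer $m$ there exist explicitly computable constants $d>0$, $e_1$, $e_2$, depending only on $m$ and $q$, such that the following holds. Let $k,n$ be positive integers with $k>2m(m+1)-1$ and $n>(m+1)k+d$, and let $u$ be the natural number whose base-$q$ expansion is \[ (u)_q=(q-1)^{(k)}\,(q-2)\,(q-1)^{(k+1)}\,(q-2)\,(q-1)^{(k+2)}\cdots(q-2)\,(q-1)^{(k+m)}\,(q-2)\,(q-1)^{(n)}. \] Then $s_q(u^2)=(q-1)(n-mk)+e_1$ and $s_q(u)=(q-1)(k(m+1)+n)+e_2$.
   Context: $s_q(n)$ denotes the sum of the digits of $n$ in base $q$. In a digit string, $x^{(a)}$ denotes the digit $x$ repeated $a$ times consecutively; the string is read from the most significant digit to the least significant. *)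

(* Defs.v *)
From mathcomp Require Import all_boot all_order all_algebra.

Set Implicit Arguments.
Unset Strict Implicit.
Unset Printing Implicit Defensive.

(* Base-q digits of n, most significant first, without leading zeros;
   meaningful for 1 < q (and digits q 0 = [:: 0]). *)
Definition digits (q n : nat) : seq nat :=
  rev [seq (n %/ q ^ i) %% q | i <- iota 0 (trunc_log q n).+1].

Definition digit_sum (q n : nat) : nat := sumn (digits q n).

(* (q-1)^(k) (q-2) (q-1)^(k+1) (q-2) ... (q-2) (q-1)^(k+m) (q-2) (q-1)^(n) *)
Definition digit_string (q m k n : nat) : seq nat :=
  flatten [seq rcons (nseq (k + i) (q - 1)) (q - 2) | i <- iota 0 m.+1]
    ++ nseq n (q - 1).

(* Total recursive functions of several natural-number arguments: Kleene's
   clauses, with minimization restricted to regular functions. *)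
Inductive recursive : forall n : nat, (n.-tuple nat -> nat) -> Prop :=
| recursive_zero n : @recursive n (fun=> 0)
| recursive_succ : @recursive 1 (fun v => (thead v).+1)
| recursive_proj n (i : 'I_n) : @recursive n (fun v => tnth v i)
| recursive_comp n p (f : p.-tuple nat -> nat)
    (g : 'I_p -> n.-tuple nat -> nat) :
    recursive f -> (forall i, recursive (g i)) ->
    @recursive n (fun v => f [tuple g i v | i < p])
| recursive_primrec n (f : n.-tuple nat -> nat) (g : n.+2.-tuple nat -> nat) :
    recursive f -> recursive g ->
    @recursive n.+1 (fun v =>
      nat_rect (fun=> nat) (f [tuple of behead v])
        (fun i r => g [tuple of i :: r :: behead v]) (thead v))
| recursive_min n (f : n.+1.-tuple nat -> nat)
    (f_regular : forall v : n.-tuple nat,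
       exists i, f [tuple of i :: v] == 0) :
    recursive f ->
    @recursive n (fun v => ex_minn (f_regular v))
| recursive_ext n (f g : n.-tuple nat -> nat) :
    f =1 g -> recursive f -> recursive g.

Definition computable_nat (f : nat -> nat -> nat) : Prop :=
  @recursive 2 (fun v => f (tnth v ord0) (tnth v ord_max)).

(* An integer is coded by a pair of naturals whose difference it is. *)
Definition computable_int (f : nat -> nat -> int) : Prop :=
  exists g h : nat -> nat -> nat,
    [/\ computable_nat g, computable_nat h
      & forall a b, f a b = ((g a b)%:Z - (h a b)%:Z)%R].

(* Main.v *)
(* Let B be the value of the blocks without the final (q-1)^(n), plus one, so
   that u + 1 = B q^n, hence u^2 = (B^2 - 1) q^(2n) + (q^n - 2B) q^n + 1.
   With M = m + 1 we have B = q^(a_M) - sum_(j <= m) q^(a_j), where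
   a_j = j (k + M) - j (j - 1) / 2.  In B^2 each negative term
   -2 q^(a_M + a_j) is paired with one occurrence of q^(a_m + a_(j+1)) (with
   q^(2 a_M) when j = m), and q^y - 2 q^x consists of the digit q - 2 at x and
   digits q - 1 strictly between x and y.  Since k is large, a_i + a_j
   determines i + j and then i j; hence these runs are disjoint, they avoid the
   exponents of the remaining terms q^(a_i + a_j), and no exponent occurs more
   than twice among the latter.  As q >= 3 there are no carries, and digit sums
   are read off.  The same argument applies to q^n - 2B. *)
Require Import Defs.
From mathcomp Require Import all_boot all_order all_algebra.
From mathcomp Require Import zify.

Set Implicit Arguments.
Unset Strict Implicit.
Unset Printing Implicit Defensive.

Import GRing.Theory.

(** * Digit sums without carries *)

(** Positions past the length contribute zero, so any sufficient bound [L] replaces the [trunc_log]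
    of the definition, and numbers of different lengths can share one range. *)
Lemma digit_sumE q n L : 1 < q -> n < q ^ L ->
  digit_sum q n = \sum_(i < L) (n %/ q ^ i) %% q.
Proof.
move=> q1 nL; rewrite /digit_sum /digits sumn_rev sumnE big_map.
have tl : n < q ^ (trunc_log q n).+1 by apply: trunc_log_ltn.
rewrite -[X in iota 0 X]subn0 -/(index_iota 0 _).
have aux b c : n < q ^ b -> b <= c ->
    \sum_(0 <= i < c) (n %/ q ^ i) %% q = \sum_(0 <= i < b) (n %/ q ^ i) %% q.
  move=> nb bc; rewrite (@big_cat_nat _ _ _ b) //= [X in _ + X]big_nat_cond.
  rewrite [X in _ + X]big1 ?addn0 // => i /andP[/andP[bi _] _].
  by rewrite divn_small ?mod0n // (leq_trans nb) // leq_exp2l.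
rewrite -(big_mkord xpredT (fun i => (n %/ q ^ i) %% q)).
by case: (leqP L (trunc_log q n).+1) => h; [|symmetry]; apply: aux => //; apply: ltnW.
Qed.

Lemma digit_sum_cat q t a b : 1 < q -> b < q ^ t ->
  digit_sum q (a * q ^ t + b) = digit_sum q a + digit_sum q b.
Proof.
move=> q1 bt; have q0 : 0 < q by apply: ltnW.
have aL : a < q ^ a by apply: ltn_expl.
have abL : a * q ^ t + b < q ^ (t + a).
  by rewrite expnD mulnC -addnS; nia.
rewrite (digit_sumE q1 abL) (digit_sumE q1 aL) (digit_sumE q1 bt).
rewrite big_split_ord /= addnC; congr (_ + _).
  apply: eq_bigr => i _.
  by rewrite expnD divnMA divnMDl ?expn_gt0 ?q0 // (divn_small bt) addn0.
apply: eq_bigr => i _.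
have -> : q ^ t = q ^ (t - i.+1) * q * q ^ i.
  by rewrite -expnSr -expnD; congr (q ^ _); have := ltn_ord i; lia.
by rewrite !mulnA divnMDl ?expn_gt0 ?q0 // modnMDl.
Qed.

Lemma digit_sum_small q n : 1 < q -> n < q -> digit_sum q n = n.
Proof.
move=> q1 nq; rewrite (@digit_sumE _ _ 1) ?expn1 // big_ord1 expn0 divn1.
exact: modn_small.
Qed.

Lemma digit_sum_poly q L (c : nat -> nat) : 1 < q -> (forall t, c t < q) ->
  digit_sum q (\sum_(t < L) c t * q ^ t) = \sum_(t < L) c t.
Proof.
move=> q1 cq; have q0 : 0 < q by apply: ltnW.
(* The induction needs the bound on the partial sum to split off the top digit with
   [digit_sum_cat]. *)
suff [] : \sum_(t < L) c t * q ^ t < q ^ L /\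
  digit_sum q (\sum_(t < L) c t * q ^ t) = \sum_(t < L) c t by [].
elim: L => [|L [ltL IH]]; first by rewrite !big_ord0 digit_sum_small.
rewrite !big_ord_recr /= [X in digit_sum q X]addnC digit_sum_cat // IH.
rewrite digit_sum_small //; split; last exact: addnC.
apply: (@leq_trans ((c L).+1 * q ^ L)).
  by rewrite mulSn ltn_add2r.
by rewrite expnS leq_mul2r cq orbT.
Qed.

Lemma sum_pred1 L e (F : nat -> nat) : e < L ->
  \sum_(t < L) (e == t) * F t = F e.
Proof.
move=> eL; rewrite (bigD1 (Ordinal eL)) //= eqxx mul1n big1 ?addn0 // => t.
by rewrite -val_eqE /= eq_sym => /negbTE ->.
Qed.

(* The digits, at position [t], of [q ^ y - 2 * q ^ x]. *)
Definition borrow q x y t := (x <= t < y) * (q - 1) - (x == t).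

(** One copy of [q ^ x] fills the digit [q - 2] up to [q - 1]; the other then carries through the
    whole run up to [q ^ y]. *)
Lemma sum_borrow q L x y : 1 < q -> x < y -> y <= L ->
  \sum_(t < L) borrow q x y t * q ^ t + 2 * q ^ x = q ^ y.
Proof.
move=> q1 xy yL.
have qx : \sum_(t < L) (x == t :> nat) * q ^ t = q ^ x.
  by apply: (@sum_pred1 L x (fun t => q ^ t)); apply: leq_trans yL.
rewrite mul2n -addnn addnA -{1}qx -big_split /=.
under eq_bigr => t _.
  have -> : borrow q x y t * q ^ t + (x == t) * q ^ t
          = (x <= t < y) * (q - 1) * q ^ t.
    rewrite -mulnDl; congr (_ * _); rewrite /borrow subnK //.
    by case: eqP => // <-; rewrite leqnn xy /=; lia.
  over.
elim: L y xy yL {qx} => [|L IH] y xy yL; first by lia.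
rewrite big_ord_recr /=.
case: (ltnP L y) => Ly; last first.
  by rewrite andbF addn0 IH.
have -> : y = L.+1 by lia.
have xL : x <= L by lia.
rewrite xL /= mul1n.
case: (leqP L x) => Lx.
  have -> : x = L by lia.
  rewrite big1 => [|t _]; last by rewrite leqNgt ltn_ord.
  by rewrite add0n -mulSnr expnS; congr (_ * _); lia.
have := IH L Lx (leqnn L).
have -> : \sum_(t < L) (x <= t < L) * (q - 1) * q ^ t
   = \sum_(t < L) (x <= t < L.+1) * (q - 1) * q ^ t.
  by apply: eq_bigr => t _; have tL := ltn_ord t; rewrite ltnS tL (ltnW tL).
by rewrite addnAC => ->; rewrite -mulSn expnS; congr (_ * _); lia.
Qed.

Lemma sum_borrow_digits q L x y : 1 < q -> x < y -> y <= L ->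
  \sum_(t < L) borrow q x y t + 1 = (q - 1) * (y - x).
Proof.
move=> q1 xy yL.
have qx : \sum_(t < L) (x == t :> nat) = 1.
  have := @sum_pred1 L x (fun=> 1) (leq_trans xy yL).
  by under eq_bigr => t _ do rewrite muln1.
rewrite -{1}qx -big_split /=.
under eq_bigr => t _.
  have -> : borrow q x y t + (x == t) = (x <= t < y) * (q - 1).
    rewrite /borrow subnK //.
    by case: eqP => // <-; rewrite leqnn xy /=; lia.
  over.
rewrite -big_distrl /= mulnC; congr (_ * _).
rewrite -(big_mkord xpredT (fun t => (x <= t < y) : nat)).
rewrite (@big_cat_nat _ _ _ y) //= (@big_cat_nat _ _ _ x) //=; last exact: ltnW.
rewrite [X in X + _ + _]big_nat_cond [X in X + _ + _]big1; last by lia.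
rewrite [X in _ + X]big_nat_cond [X in _ + X]big1; last by lia.
rewrite add0n addn0 (eq_big_nat _ _ (F2 := fun=> 1)); last by lia.
by rewrite sum_nat_const_nat muln1.
Qed.

(** Each [- 2 * q ^ x i] borrows from its [q ^ y i]. Once every column total is below [q], these
    totals are the digits of [N]; a run then contributes [(q - 1) * (y i - x i) - 1] and a free
    power contributes 1. *)
Lemma digit_sum_sparse q (I J : finType) (x y : I -> nat) (e : J -> nat) N :
    1 < q -> (forall i, x i < y i) ->
    (forall t, \sum_i borrow q (x i) (y i) t + \sum_j (e j == t) < q) ->
    N + 2 * \sum_i q ^ x i = \sum_i q ^ y i + \sum_j q ^ e j ->
  digit_sum q N + #|I| = (q - 1) * \sum_i (y i - x i) + #|J|.
Proof.
move=> q1 xy cq NE.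
pose L := \sum_i y i + (\sum_j e j).+1.
have yL i : y i <= L by rewrite /L (bigD1 i) //=; lia.
have eL j : e j < L by rewrite /L (bigD1 j) //=; lia.
pose c t := \sum_i borrow q (x i) (y i) t + \sum_j (e j == t).
have Nc : N = \sum_(t < L) c t * q ^ t.
  apply/eqP; rewrite -(eqn_add2r (2 * \sum_i q ^ x i)) NE.
  under eq_bigr => i _ do rewrite -(sum_borrow q1 (xy i) (yL i)).
  under [X in _ + X == _]eq_bigr => j _ do
    rewrite -(sum_pred1 (fun t => q ^ t) (eL j)).
  rewrite big_split /= -big_distrr /= exchange_big /=.
  rewrite [X in _ + X == _]exchange_big /= addnAC -big_split /=.
  rewrite eqn_add2r; apply/eqP/eq_bigr => t _.
  by rewrite mulnDl !big_distrl.
rewrite Nc digit_sum_poly // big_split /= addnAC; congr (_ + _).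
  rewrite exchange_big /= -sum1_card -big_split big_distrr /=.
  by apply: eq_bigr => i _; apply: sum_borrow_digits.
rewrite exchange_big /= -sum1_card; apply: eq_bigr => j _.
apply: etrans (sum_pred1 (fun=> 1) (eL j)).
by apply: eq_bigr => t _; rewrite muln1.
Qed.

(** * The value of the digit string *)

Definition from_digits q (s : seq nat) := foldl (fun v c => v * q + c) 0 s.

Lemma digitsK q n : 1 < q -> from_digits q (digits q n) = n.
Proof.
move=> q1; rewrite /from_digits /digits foldl_rev.
suff H L j : n %/ q ^ j < q ^ L ->
    foldr (fun c v => v * q + c) 0 [seq (n %/ q ^ i) %% q | i <- iota j L]
      = n %/ q ^ j.
  by rewrite H expn0 divn1 ?trunc_log_ltn.
elim: L j => [|L IH] j /=.
  by rewrite expn0 ltnS leqn0 => /eqP.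
move=> nj; rewrite IH.
  rewrite expnSr divnMA; exact/esym/divn_eq.
by rewrite expnSr divnMA ltn_divLR ?(ltnW q1) // -expnSr.
Qed.

(* [q ^ n * block_value q k i - 1] is the value of the digit string with [i]
   blocks; the shift by one turns a digit [q - 1] into a multiplication by [q]. *)
Fixpoint block_value q k i :=
  if i is i'.+1 then q ^ (k + i) * block_value q k i' - 1 else 1.

Lemma block_value_gt0 q k i : 2 < q -> 0 < k -> 0 < block_value q k i.
Proof.
move=> q2 k0; elim: i => // i IH /=; rewrite subn_gt0.
have : q ^ 1 <= q ^ (k + i.+1) by rewrite leq_exp2l; lia.
rewrite expn1; nia.
Qed.

Lemma from_digits_string q m k n : 2 < q -> 0 < k ->
  (from_digits q (digit_string q m k n)).+1 = block_value q k m.+1 * q ^ n.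
Proof.
move=> q2 k0; rewrite /from_digits /digit_string foldl_cat.
set f := foldl _.
have nines v c : (f v (nseq c (q - 1))).+1 = v.+1 * q ^ c.
  elim: c v => [|c IH] v /=; first by rewrite muln1.
  by rewrite IH expnS mulnA; congr (_ * _); nia.
rewrite nines; congr (_ * _).
elim: m.+1 => [|i IH] //.
rewrite -[in iota _ _]addn1 iotaD map_cat flatten_cat /f foldl_cat -/f add0n /= cats0.
rewrite -cats1 /f foldl_cat -/f /=.
set w := f 0 _ in IH *; have := nines w (k + i).
rewrite IH /=; move: (f _ (nseq _ _)) => z zE.
(* Appending the digit [q - 2] to [z] gives [z * q + (q - 2)], whose successor is [z.+1 * q - 1]. *)
by rewrite addnS expnS -mulnA [q ^ _ * _]mulnC -zE; nia.
Qed.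

(** The string has [k * m.+1 + 'C(m.+2, 2) + n] digits, and [m.+1] of them fall short of [q - 1] by
    one. *)
Lemma sumn_digit_string q m k n : 2 < q ->
  sumn (digit_string q m k n) + m.+1 =
  (q - 1) * (k * m.+1 + n + 'C(m.+2, 2)).
Proof.
case: q => [|[|[|q]]] // _; rewrite /digit_string sumn_cat sumn_nseq.
rewrite -[q.+3 - 1]/q.+2 -[q.+3 - 2]/q.+1.
elim: m => [|m IH].
  rewrite /= cats0 addn0 sumn_rcons sumn_nseq binn; lia.
rewrite -[in iota _ _]addn1 iotaD map_cat flatten_cat sumn_cat.
set S := sumn (flatten _) in IH *.
by rewrite /= cats0 add0n sumn_rcons sumn_nseq binS bin1; lia.
Qed.

(* Position of the [j]-th non-zero digit of [q ^ pos k M M - block_value q k M]. *)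
Definition pos k M j := j * (k + M) - 'C(j, 2).

(** Doubling removes the halving in the binomial, and [j <= M] keeps the subtraction exact, so later
    position arithmetic is polynomial. *)
Lemma posE k M j : j <= M -> 2 * pos k M j + j * j = 2 * j * (k + M) + j.
Proof.
move=> jm; have := bin2 j; rewrite /pos => ->; have := odd_double_half (j * j.-1).
rewrite oddM; case: j jm => //= j jm; rewrite andNb add0n => jE.
nia.
Qed.

Lemma pos0 k M : pos k M 0 = 0.
Proof. by []. Qed.

Lemma posS k M j : j <= M -> pos k M.+1 j.+1 = k + M.+1 + pos k M j.
Proof.
move=> jM; have := @posE k M.+1 j.+1 jM; have := @posE k M j jM; nia.
Qed.

(** A new block shifts all earlier positions by [k + M.+1], which is [posS]; its [- 1] is the new
    term at position 0. *)
Lemma block_valueE q k M : 2 < q -> 0 < k ->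
  block_value q k M + \sum_(j < M) q ^ pos k M j = q ^ pos k M M.
Proof.
move=> q2 k0; elim: M => [|M IH]; first by rewrite big_ord0.
rewrite big_ord_recl /= posS // [in RHS]expnD -IH mulnDr addnA.
rewrite subnK; last by have := block_value_gt0 M.+1 q2 k0; rewrite /= subn_gt0; lia.
congr (_ + _); rewrite big_distrr; apply: eq_bigr => j _.
by rewrite posS ?expnD // ltnW.
Qed.

(** * Sums of two positions *)

Section Positions.

Variables k m : nat.
Local Notation M := m.+1.
Local Notation K := (k + m.+1).
Local Notation a := (pos k m.+1).

Lemma ltn_pos i j : i < j -> j <= M -> a i < a j.
Proof.
move=> ij jM; have := @posE k M i; have := @posE k M j jM.
move=> aj ai; have {}ai := ai (ltnW (leq_trans ij jM)).
nia.
Qed.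

Lemma pos_inj i j : i <= M -> j <= M -> a i = a j -> i = j.
Proof.
move=> iM jM aij; case: (ltngtP i j) => // h; have := ltn_pos h; lia.
Qed.

(* For a fixed sum [i + j], the sum of positions increases with [i * j]. *)
Lemma pos_mul i j i' j' : i <= M -> j <= M -> i' <= M -> j' <= M ->
  i + j = i' + j' -> a i + a j + i' * j' = a i' + a j' + i * j.
Proof.
move=> iM jM iM' jM' ijE.
have := @posE k M i iM; have := @posE k M j jM.
have := @posE k M i' iM'; have := @posE k M j' jM'.
have : (i + j) * (i + j) = (i' + j') * (i' + j') by rewrite ijE.
have : (i + j) * K = (i' + j') * K by rewrite ijE.
lia.
Qed.

(* The exponent of the power of [q] from which [- 2 * q ^ (a M + a j)] borrows. *)
Definition upper j := if j < m then a m + a j.+1 else a M + a M.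

Lemma ltn_upper j : j < M -> a M + a j < upper j.
Proof.
move=> jM; rewrite /upper; case: ifP => jm; last by have := @ltn_pos j M; lia.
have := @pos_mul M j m j.+1; nia.
Qed.

(** By [pos_mul] the run of index [j < m] has length [m - j]; the last one has length
    [a M - a m = k.+1]. *)
Lemma sum_upper :
  \sum_(j < M) (upper j - (a M + a j)) = k.+1 + 'C(M, 2).
Proof.
rewrite big_ord_recr /= addnC; congr (_ + _).
  rewrite /upper ltnn subnDl; have := @posS k m m; have := @posE k M M.
  have := @posE k M m; lia.
rewrite -triangular_sum big_mkord big_ord_recl add0n /= (reindex_inj rev_ord_inj).
apply: eq_bigr => i _ /=; have : i < m := ltn_ord i.
rewrite /upper /bump /=; set j := m - i.+1 => im; have jE : j + i.+1 = m by lia.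
have jM : j.+1 <= M by lia.
rewrite ifT; last by lia.
by have := @pos_mul M j m j.+1 (leqnn _) (ltnW jM) (leqnSn _) jM; lia.
Qed.

Hypothesis k_large : 2 * m * m.+1 <= k.

(** [a i] falls short of [i * K] by ['C(i, 2)], so two terms lose at most [m * M], which is below
    [K]: sums with distinct [i + j] occupy disjoint windows. *)
Lemma pos_window i j : i <= M -> j <= M ->
  (i + j) * K < a i + a j + K /\ a i + a j <= (i + j) * K.
Proof.
move=> iM jM; have := @posE k M i iM; have := @posE k M j jM.
move=> ai aj.
have ii : i * i <= i + m * M by nia.
have jj : j * j <= j + m * M by nia.
have mK : m * M < K by nia.
have i2 : i <= i * i by nia.
have j2 : j <= j * j by nia.
lia.
Qed.

Lemma window_inj i j i' j' t : i <= M -> j <= M -> i' <= M -> j' <= M ->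
  a i + a j <= t <= a i' + a j' -> i + j <= i' + j'.
Proof.
move=> iM jM iM' jM' t_in.
have [h1 _] := pos_window iM jM; have [_ h2] := pos_window iM' jM'.
rewrite leqNgt; apply/negP => h.
have : (i' + j').+1 * K <= (i + j) * K by rewrite leq_mul2r h orbT.
rewrite mulSn; lia.
Qed.

Lemma pair_pos_inj i j i' j' : i <= M -> j <= M -> i' <= M -> j' <= M ->
  a i + a j = a i' + a j' -> (i = i' /\ j = j') \/ (i = j' /\ j = i').
Proof.
move=> iM jM iM' jM' aE.
have s1 : i + j <= i' + j' by apply: (@window_inj _ _ _ _ (a i + a j)) => //; lia.
have s2 : i' + j' <= i + j by apply: (@window_inj _ _ _ _ (a i + a j)) => //; lia.
have sE : i + j = i' + j' by lia.
have := pos_mul iM jM iM' jM' sE; rewrite aE => /addnI pE.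
(* Sum and product agree, so [i] is a root of the quadratic with roots [i'] and [j']. *)
have /eqP : ((i%:Z - i'%:Z) * (i%:Z - j'%:Z) = 0)%R by lia.
by rewrite mulf_eq0 => /orP[] /eqP iE; [left | right]; lia.
Qed.

Lemma count_pairs t :
  \sum_(i < M) \sum_(j < M) (a i + a j == t) <= 2.
Proof.
have -> : \sum_(i < M) \sum_(j < M) (a i + a j == t)
        = #|[set p : 'I_M * 'I_M | a p.1 + a p.2 == t]|.
  rewrite pair_big -sum1_card [RHS]big_mkcond /=.
  by apply: eq_bigr => p _; rewrite inE; case: eqP.
set S := [set _ | _]; case: (set_0Vmem S) => [->|[[i j]]]; first by rewrite cards0.
rewrite inE /= => /eqP ijt.
have : #|[set (i, j); (j, i)]| <= 2 by rewrite cards2; case: eqP.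
apply/leq_trans/subset_leq_card/subsetP => -[i' j']; rewrite !inE /= -ijt => /eqP.
have leM (l : 'I_M) : l <= M by apply: ltnW.
move=> /(pair_pos_inj (leM _) (leM _) (leM _) (leM _))[] [/ord_inj-> /ord_inj->].
  by rewrite eqxx.
by rewrite eqxx orbT.
Qed.

(** Here [i < m], so both ends of run [i] have index sum [M + i], while run [j] starts in the later
    window of [M + j]. *)
Lemma upper_sep i j t : i < j -> j < M -> t < upper i -> a M + a j <= t -> False.
Proof.
move=> ij jM; rewrite /upper; case: ifP => im; last by lia.
move=> ti tj.
have i1M : i.+1 <= M by apply: ltnW.
have := @window_inj M j m i.+1 t (leqnn _) (ltnW jM) (leqnSn _) i1M; lia.
Qed.

(** The windows force [i + j = m + l.+1]. With both indices at most [m], the product [i * j] is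
    least at the extreme pair [(m, l.+1)], so by [pos_mul] the sum is already at least [upper l]. *)
Lemma upper_pairs i j l t : i <= m -> j <= m -> l < M ->
  a M + a l <= t < upper l -> a i + a j <> t.
Proof.
move=> im jm lM /andP[lt tu] tE.
have iM : i <= M by lia.
have jM : j <= M by lia.
have s1 : M + l <= i + j.
  by apply: (@window_inj _ _ _ _ t) => //; rewrite ?tE ?lt ?leqnn // ltnW.
move: tu; rewrite /upper; case: ifP => lm; last by lia.
move=> tu; have s2 : i + j <= m + l.+1.
  by apply: (@window_inj _ _ _ _ t) => //; lia.
have sE : i + j = m + l.+1 by lia.
have := pos_mul iM jM (leqnSn _) lM sE.
nia.
Qed.

End Positions.

(** * Digit sums of [B ^ 2] and [q ^ n - 2 * B] *)

Section BlockValue.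

Variables q k m : nat.
Hypotheses (q_gt2 : 2 < q) (k_gt0 : 0 < k).

Local Notation M := m.+1.
Local Notation a := (pos k m.+1).
Local Notation B := (block_value q k m.+1).

(** On squaring [B = q ^ a M - A], row [m] of [A * A] supplies the partners [q ^ (a m + a j.+1)];
    its entry [j = 0] remains as [q ^ a m]. *)
Lemma block_value_sqr :
  B ^ 2 + 2 * \sum_(j < M) q ^ (a M + a j)
  = \sum_(j < M) q ^ upper k m j
    + (\sum_(i < m) \sum_(j < M) q ^ (a i + a j) + q ^ a m).
Proof.
have BE := @block_valueE q k M q_gt2 k_gt0; set A := \sum_(j < M) _ in BE.
have AA : A * A = \sum_(i < m) \sum_(j < M) q ^ (a i + a j) + q ^ a m
    + \sum_(j < m) q ^ (a m + a j.+1).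
  transitivity (\sum_(i < M) \sum_(j < M) q ^ (a i + a j)).
    rewrite /A big_distrl; apply: eq_bigr => i _; rewrite big_distrr /=.
    by apply: eq_bigr => j _; rewrite expnD.
  rewrite big_ord_recr /= -addnA; congr (_ + _).
  by rewrite big_ord_recl /= pos0 addn0.
have -> : \sum_(j < M) q ^ upper k m j
    = \sum_(j < m) q ^ (a m + a j.+1) + q ^ (a M + a M).
  rewrite big_ord_recr /= {2}/upper ltnn; congr (_ + _).
  by apply: eq_bigr => j _; rewrite /upper ltn_ord.
have -> : \sum_(j < M) q ^ (a M + a j) = q ^ a M * A.
  by rewrite /A big_distrr; apply: eq_bigr => j _; rewrite expnD.
rewrite expnD -BE; lia.
Qed.

Lemma digit_sum_block_value_sqr_pred :
  digit_sum q (B ^ 2 - 1) + 1 = digit_sum q (B ^ 2).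
Proof.
have q1 : 1 < q by apply: ltnW.
have [z BE] : exists z, B ^ 2 = z * q + 1.
  have := block_value_gt0 M q_gt2 k_gt0; rewrite /= addnS expnS.
  rewrite -mulnA; set c := _ * block_value q k m => w0.
  (* Here [B = q * c - 1], so [B ^ 2 = q * c * (q * c - 2) + 1] and the last digit is 1. *)
  by exists (c * (q * c - 2)); rewrite -mulnn; nia.
rewrite BE addnK -{1}[z * q]addn0 -[X in z * X](expn1 q).
rewrite !digit_sum_cat ?expn1 ?(ltnW q1) //.
by rewrite (digit_sum_small q1 (ltnW q1)) (digit_sum_small q1 q1) addn0.
Qed.

Lemma digit_sum_compl n : a M < n -> 2 * B <= q ^ n ->
  digit_sum q (q ^ n - 2 * B) + 1 = (q - 1) * (n - a M) + 2 * M.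
Proof.
move=> an Bn; have q1 : 1 < q by apply: ltnW.
(* The [bool] component counts each [q ^ a j] twice, as [- 2 * B] does; the single run goes from
   [a M] to [n]. *)
pose e (p : 'I_M * bool) := a p.1.
have eE (F : nat -> nat) : \sum_p F (e p) = 2 * \sum_(j < M) F (a j).
  rewrite -(pair_big xpredT xpredT (fun (i : 'I_M) (b : bool) => F (a i))) /=.
  rewrite big_distrr.
  by apply: eq_bigr => j _; rewrite big_bool /= mul2n addnn.
have := @digit_sum_sparse q 'I_1 _ (fun=> a M) (fun=> n) e (q ^ n - 2 * B) q1.
rewrite card_prod card_bool !card_ord mulnC !big_ord1 [M * 2]mulnC; apply=> //.
  move=> t; rewrite big_ord1 (eE (fun s => s == t : nat)).
  have [at_n|at_n] := boolP (a M <= t < n).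
    rewrite big1 ?muln0 ?addn0 => [|j _].
      by apply: leq_ltn_trans (leq_subr _ _) _; rewrite at_n; lia.
    by apply/eqP; rewrite eqb0; have := @ltn_pos k m j M (ltn_ord j) (leqnn _); lia.
  have -> : borrow q (a M) n t = 0 by rewrite /borrow (negbTE at_n).
  suff : \sum_(j < M) (a j == t) <= 1 by lia.
  case: (pickP (fun j : 'I_M => a j == t)) => [l /eqP lt|no]; last first.
    by rewrite big1 // => j _; rewrite no.
  rewrite (bigD1 l) //= big1 => [|j jl]; first by case: (_ == _).
  apply/eqP; rewrite eqb0 -lt; apply: contraNneq jl => /pos_inj jE.
  by apply/eqP/ord_inj/jE; apply: ltnW.
rewrite (eE (fun t => q ^ t)).
by have := @block_valueE q k M q_gt2 k_gt0; lia.
Qed.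

Hypothesis k_large : 2 * m * m.+1 <= k.

Lemma digit_sum_block_value_sqr :
  digit_sum q (B ^ 2) + M
  = (q - 1) * (k.+1 + 'C(M, 2)) + (m * M + 1).
Proof.
have q1 : 1 < q by apply: ltnW.
(* [inl] indexes the rows below [m]; [inr] is the leftover entry [(m, 0)]. *)
pose e (p : 'I_m * 'I_M + unit) := if p is inl (i, j) then a i + a j else a m.
pose x (j : 'I_M) := a M + a j.
pose y (j : 'I_M) := upper k m j.
have eE (F : nat -> nat) : \sum_p F (e p) =
    \sum_(i < m) \sum_(j < M) F (a i + a j) + F (a m).
  rewrite big_sumType /= pair_big /=; congr (_ + _).
    by apply: eq_bigr => -[].
  by rewrite big_const card_unit /= addn0.
have xy j : x j < y j by apply: ltn_upper.
have := @digit_sum_sparse q _ _ x y e (B ^ 2) q1 xy.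
rewrite card_sum card_prod !card_ord card_unit -sum_upper; apply; last first.
  by rewrite (eE (fun t => q ^ t)) block_value_sqr.
move=> t; rewrite (eE (fun s => s == t : nat)).
have /= pairs_le2 := count_pairs k_large t.
have pairsE : \sum_(i < m) \sum_(j < M) (a i + a j == t) + (a m == t)
   <= \sum_(i < M) \sum_(j < M) (a i + a j == t).
  rewrite big_ord_recr /= leq_add2l big_ord_recl /= pos0 addn0.
  exact: leq_addr.
have borrow_le z w : borrow q z w t <= q - 1.
  by apply: leq_trans (leq_subr _ _) _; case: (_ <= t < _); rewrite ?mul1n.
have borrow0 z w : ~~ (z <= t < w) -> borrow q z w t = 0.
  by rewrite /borrow => /negbTE ->.
(* Inside a run only that run contributes, at most [q - 1]; outside all runs at most two pairs
   coincide, and [2 < q]. *)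
case: (pickP (fun j : 'I_M => x j <= t < y j)) => [l tl|no].
  rewrite (bigD1 l) //= big1 => [|j jl].
    have -> : \sum_(i < m) \sum_(j < M) (a i + a j == t) = 0.
      rewrite big1 // => i _; rewrite big1 // => j _; apply/eqP; rewrite eqb0.
      apply/eqP/(@upper_pairs _ _ k_large _ _ l) => //; last exact: ltn_ord j.
      by rewrite ltnW.
    have -> : (a m == t) = false.
      apply/eqP => amt; apply: (@upper_pairs _ _ k_large m 0 l t) => //.
      by rewrite pos0 addn0.
    by have := borrow_le (x l) (y l); lia.
  apply: borrow0; apply/negP => tj; move: tl tj => /andP[xl ly] /andP[xj jy].
  case: (ltngtP j l) => [jl'|lj|/ord_inj jE]; last by rewrite jE eqxx in jl.
    exact: (@upper_sep _ _ k_large j l t).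
  exact: (@upper_sep _ _ k_large l j t).
rewrite big1 => [|j _]; last by apply: borrow0; rewrite no.
by rewrite add0n (leq_ltn_trans pairsE) // (leq_ltn_trans pairs_le2).
Qed.

End BlockValue.

(** * Digit sum of [u ^ 2] *)

Lemma digit_sum_sqr q k m n u : 2 < q -> 0 < k -> 2 * m * m.+1 <= k ->
    m.+1 * k + 'C(m.+2, 2) < n ->
    u.+1 = block_value q k m.+1 * q ^ n ->
  digit_sum q (u ^ 2) + (q - 1) * (m * k) + (1 + q * m.+1)
  = (q - 1) * n + (q + m * m.+1 + 2 * m.+1).
Proof.
move=> q2 k0 km kn uE; have q1 : 1 < q by apply: ltnW.
have aM : pos k m.+1 m.+1 = m.+1 * k + 'C(m.+2, 2).
  have := @posE k m.+1 m.+1 (leqnn _).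
  by have := mul_bin_diag m.+2 1; rewrite bin1 /=; lia.
have an : pos k m.+1 m.+1 < n by rewrite aM.
have B0 := @block_value_gt0 q k m.+1 q2 k0.
have Bn : 2 * block_value q k m.+1 <= q ^ n.
  have qn : q ^ (pos k m.+1 m.+1).+1 <= q ^ n by rewrite leq_exp2l.
  apply: leq_trans qn; rewrite expnS -(@block_valueE q k m.+1 q2 k0).
  by apply: leq_mul; [exact: ltnW | exact: leq_addr].
have sqr := digit_sum_block_value_sqr q2 k0 km.
have pred := digit_sum_block_value_sqr_pred m q2 k0.
have compl := digit_sum_compl q2 k0 an Bn.
have binE : 'C(m.+2, 2) = 'C(m.+1, 2) + m.+1 by rewrite binS bin1.
move: (block_value _ _ _) B0 Bn uE sqr pred compl => B B0 Bn uE sqr pred compl.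
have qn1 : 1 < q ^ n by rewrite -(exp1n n) ltn_exp2r //; lia.
have -> : u ^ 2 = ((B ^ 2 - 1) * q ^ n + (q ^ n - 2 * B)) * q ^ n + 1.
  have uu : u.+1 * u.+1 = B ^ 2 * (q ^ n * q ^ n) by rewrite uE -mulnn; lia.
  have B2 : 0 < B ^ 2 by rewrite expn_gt0 B0.
  rewrite mulnDl !mulnBl mul1n -mulnA -mulnn; nia.
rewrite !digit_sum_cat //; last by lia.
rewrite (digit_sum_small q1 q1) aM in compl *.
have : (q - 1) * (n - (m.+1 * k + 'C(m.+2, 2)))
    + (q - 1) * (m.+1 * k + 'C(m.+2, 2)) = (q - 1) * n.
  by rewrite -mulnDr subnK // -aM ltnW.
rewrite binE; lia.
Qed.

(** * Computability of the constants *)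

Lemma recursive_comp1 n (f : nat -> nat) (g : n.-tuple nat -> nat) :
  @recursive 1 (fun v => f (thead v)) -> recursive g ->
  recursive (fun v => f (g v)).
Proof.
move=> rf rg; pose h (_ : 'I_1) := g.
apply: recursive_ext (recursive_comp (g := h) rf (fun=> rg)) => v.
by rewrite /thead tnth_mktuple.
Qed.

Lemma recursive_comp2 n (f : nat -> nat -> nat) (g h : n.-tuple nat -> nat) :
  computable_nat f -> recursive g -> recursive h ->
  recursive (fun v => f (g v) (h v)).
Proof.
move=> rf rg rh; pose gh (i : 'I_2) := if i == ord0 then g else h.
have rgh i : recursive (gh i) by rewrite /gh; case: ifP.
by apply: recursive_ext (recursive_comp rf rgh) => v; rewrite !tnth_mktuple.
Qed.

Lemma recursive_const n c : @recursive n (fun=> c).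
Proof.
elim: c => [|c IH]; first exact: recursive_zero.
exact: (recursive_comp1 recursive_succ IH).
Qed.

Lemma nth_behead_last (v : 2.-tuple nat) : nth 0 (behead v) 0 = tnth v ord_max.
Proof. by rewrite (tnth_nth 0) nth_behead. Qed.

Lemma computable_add : computable_nat addn.
Proof.
pose f (v : 1.-tuple nat) := tnth v ord0.
(* In a step function, entry 0 is the recursion index, entry 1 the previous value, and the
   parameters follow. *)
pose g (v : 3.-tuple nat) := (tnth v (inord 1)).+1.
have rf : recursive f by apply: recursive_proj.
have rg : recursive g.
  exact: (recursive_comp1 recursive_succ (recursive_proj (inord 1))).
apply: recursive_ext (recursive_primrec rf rg) => v.
rewrite -nth_behead_last /thead; elim: (tnth v ord0) => [|x IH] /=.
  by rewrite /f (tnth_nth 0).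
by rewrite [LHS]/g (tnth_nth 0) inordK //= IH.
Qed.

Lemma recursive_add n (f g : n.-tuple nat -> nat) :
  recursive f -> recursive g -> recursive (fun v => f v + g v).
Proof. exact: recursive_comp2 computable_add. Qed.

Lemma computable_mul : computable_nat muln.
Proof.
pose g (v : 3.-tuple nat) := tnth v (inord 2) + tnth v (inord 1).
have rg : recursive g by apply: recursive_add; apply: recursive_proj.
apply: recursive_ext (recursive_primrec (recursive_zero 1) rg) => v.
rewrite -nth_behead_last /thead; elim: (tnth v ord0) => [|x IH] //=.
by rewrite [LHS]/g !(tnth_nth 0) !inordK //= IH.
Qed.

Lemma recursive_mul n (f g : n.-tuple nat -> nat) :
  recursive f -> recursive g -> recursive (fun v => f v * g v).
Proof. exact: recursive_comp2 computable_mul. Qed.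

(** Pascal's rule adds [x.+2] at each step, a primitive recursion starting from ['C(2, 2) = 1]. *)
Lemma recursive_triangular n (f : n.-tuple nat -> nat) :
  recursive f -> recursive (fun v => 'C((f v).+2, 2)).
Proof.
apply: (@recursive_comp1 _ (fun m => 'C(m.+2, 2))).
pose g (v : 2.-tuple nat) := tnth v ord_max + (tnth v ord0).+2.
have rg : recursive g.
  apply: recursive_add; first exact: recursive_proj.
  apply: (recursive_comp1 recursive_succ).
  by apply: (recursive_comp1 recursive_succ); apply: recursive_proj.
apply: recursive_ext (recursive_primrec (recursive_const 0 1) rg) => v.
rewrite /thead; elim: (tnth v ord0) => [|x IH] //=.
by rewrite [LHS]/g !(tnth_nth 0) /= IH [RHS]binS bin1.
Qed.

Theorem theorem3p1 :
  exists (d : nat -> nat -> nat) (e1 e2 : nat -> nat -> int),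
    [/\ computable_nat d, computable_int e1, computable_int e2 &
      forall q m : nat, 3 <= q -> 0 < m ->
        0 < d q m /\
        forall k n u : nat, 0 < k -> 0 < n ->
          2 * m * (m + 1) - 1 < k ->
          (m + 1) * k + d q m < n ->
          digits q u = digit_string q m k n ->
          ((digit_sum q (u ^ 2)%N)%:Z
            = (q%:Z - 1) * (n%:Z - m%:Z * k%:Z) + e1 q m)%R /\
          ((digit_sum q u)%:Z
            = (q%:Z - 1) * (k%:Z * (m%:Z + 1) + n%:Z) + e2 q m)%R].
Proof.
(* With this [d], [(m + 1) * k + d] is the total length of the blocks, [pos k m.+1 m.+1]. *)
exists (fun _ m => 'C(m.+2, 2)).
(* [e1] and [e2] are the constants left over in [digit_sum_sqr] and [sumn_digit_string], with the
   negative terms gathered on the right as [computable_int] requires. *)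
exists (fun q m => ((q + m * m.+1 + 2 * m.+1)%:Z - (1 + q * m.+1)%:Z)%R).
exists (fun q m => ((q * 'C(m.+2, 2))%:Z - ('C(m.+2, 2) + m.+1)%:Z)%R).
have rq : @recursive 2 (fun v => tnth v ord0) by apply: recursive_proj.
have rm : @recursive 2 (fun v => tnth v ord_max) by apply: recursive_proj.
have rm1 := recursive_comp1 recursive_succ rm.
have rT := recursive_triangular rm.
have cT : computable_nat (fun _ m => 'C(m.+2, 2)) by exact: rT.
split=> //.
- exists (fun q m => q + m * m.+1 + 2 * m.+1), (fun q m => 1 + q * m.+1); split=> //.
    apply: recursive_add; last exact: recursive_mul (recursive_const 2 2) rm1.
    exact: recursive_add rq (recursive_mul rm rm1).
  exact: recursive_add (recursive_const 2 1) (recursive_mul rq rm1).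
- exists (fun q m => q * 'C(m.+2, 2)), (fun _ m => 'C(m.+2, 2) + m.+1); split=> //.
    exact: recursive_mul rq rT.
  exact: recursive_add rT rm1.
move=> q m q3 m0; split; first by rewrite bin_gt0.
move=> k n u k0 _ km kn uE.
have q1 : 1 < q by apply: ltnW.
have km' : 2 * m * m.+1 <= k by lia.
have uS : u.+1 = block_value q k m.+1 * q ^ n.
  by rewrite -(from_digits_string m n q3 k0) -uE digitsK.
have su : digit_sum q u = sumn (digit_string q m k n) by rewrite -uE.
have kn' : m.+1 * k + 'C(m.+2, 2) < n by lia.
have := digit_sum_sqr q3 k0 km' kn' uS.
have := sumn_digit_string m k n q3; rewrite -su.
by split; nia.
Qed.
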